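(* (a) For any integers $n \ge 1$ and $k$ with $-n+1 \le k \le n$, we have $$a^*_{k,n} < \frac{1}{\sqrt{\pi n}}\, e^{-b^*_{k,n}} \, \exp\left(\frac{2}{3n}\right).$$ (b) For any real $r \in (0,1)$ and any integers $n \ge 1$ and $k$ with $|k| \le rn$, we have $$a^*_{k,n} > \frac{1}{\sqrt{\pi n}}\, e^{-b^*_{k,n}} \, \exp\left(- \frac{1}{n} - \frac{r^4}{3(1-r^2)^2 \, n}\right) .$$ (c) For any integers $n \ge 4$ and $k$ with $|k| \le n^{\frac23}$, one has $$1 - 3 n^{-\frac13} < \frac{a^*_{k,n}}{\frac{1}{\sqrt{\pi n}}\, e^{-\frac{k^2}{n}}} < 1 + 6 n^{-\frac13} .$$
   Context: Let $(X_r)_{r \ge 1}$ be independent, identically distributed random variables with $\mathbb{P}(X_r = 1) = \mathbb{P}(X_r = -1) = \frac12$, and let $S_0 = 0$, $S_\ell = \sum_{r=1}^{\ell} X_r$ for $\ell \ge 1$ (simple symmetric random walk). For integers $n \ge 1$ and $k$ with $-n+1 \le k \le n$ put $$a^*_{k,n} := \mathbb{P}(S_{2n-1} = 2k-1) = \binom{2n-1}{n+k-1}2^{-2n+1} .$$ For $n \ge 1$ and $|k| < n$ define $$b^*_{k,n} := n \left\{\left(1 + \frac{k-\frac12}{n}\right) \log\left(1 + \frac{k}{n}\right) + \left(1 - \frac{k-\frac12}{n}\right) \log\left(1 - \frac{k}{n}\right)\right\},$$ and for $n \ge 1$ and $k = n$ define $$b^*_{n,n} := \left(2n - \frac12\right)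 \log 2 - \frac12 \log(2 \pi n) .$$ Here $\log$ is the natural logarithm. *)

(* Defs.v *)
From HB Require Import structures.
From mathcomp Require Export all_boot all_order all_algebra.
From mathcomp Require Export finmap.
From mathcomp Require Export all_classical all_reals all_analysis.
Export Order.TTheory GRing.Theory Num.Theory.
Export numFieldNormedType.Exports.

Set Implicit Arguments.
Unset Strict Implicit.
Unset Printing Implicit Defensive.

Local Open Scope classical_set_scope.
Local Open Scope ring_scope.

Section random_walk.
Context {R : realType} {d : measure_display} {T : measurableType d}.
Context (P : probability T R).

Definition mutually_independent (I : choiceType) (D : set I)
    (X : I -> {RV P >-> R}) : Prop :=
  forall J : {fset I}, [set` J] `<=` D ->
  forall A : I -> set R, (forall i, i \in J -> measurable (A i)) ->
    P (\bigcap_(i in [set` J]) (X i @^-1` A i)) =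
    (\prod_(i <- J) P (X i @^-1` A i))%E.

Definition identically_distributed (I : Type) (D : set I)
    (X : I -> {RV P >-> R}) : Prop :=
  forall i j, D i -> D j -> forall A : set R, measurable A ->
    distribution P (X i) A = distribution P (X j) A.

(* The steps are X 1, X 2, ...; X 0 is unconstrained and never used. *)
Definition simple_symmetric_steps (X : nat -> {RV P >-> R}) : Prop :=
  [/\ mutually_independent [set r | (1 <= r)%N] X,
      identically_distributed [set r | (1 <= r)%N] X
    & forall r, (1 <= r)%N ->
        P [set w | X r w = 1] = (2^-1)%:E /\
        P [set w | X r w = -1] = (2^-1)%:E].

Definition walk (X : nat -> {RV P >-> R}) (l : nat) (w : T) : R :=
  \sum_(1 <= r < l.+1) X r w.

Definition astar (X : nat -> {RV P >-> R}) (n : nat) (k : int) : R :=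
  fine (P [set w | walk X (2 * n - 1)%N w = (2 * k - 1)%:~R]).

End random_walk.

(* Only meaningful for 1 <= n and - n < k <= n. *)
Definition bstar (R : realType) (n : nat) (k : int) : R :=
  if k == n%:Z then (2 * n%:R - 1 / 2) * ln 2 - 1 / 2 * ln (2 * pi * n%:R)
  else n%:R *
    ((1 + (k%:~R - 1 / 2) / n%:R) * ln (1 + k%:~R / n%:R) +
     (1 - (k%:~R - 1 / 2) / n%:R) * ln (1 - k%:~R / n%:R)).

(* Main.v *)
From mathcomp Require Import ring lra zify.
Require Import Defs.

(** The number of up-steps of the walk is binomial, so [astar X n k] is the
    binomial coefficient of [n + k - 1] in [2 n - 1] divided by [2 ^ (2 n - 1)].
    To derive this from independence, consider the cylinder events that prescribe
    all of the first [l] steps: they are disjoint and have probability [2 ^- l]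
    each, and counting those that lie in an event and those that lie in its
    complement pins down the probability of the event ([probability_walk]).

    Everything else rests on Stirling's formula with explicit error. Write
    [e(m)] for the logarithm of [m! / (sqrt (2 pi m) (m / e)^m)]. Expressing the
    binomial coefficient by factorials shows that, for [|k| < n],
      [astar X n k = exp (- bstar) / sqrt (pi n) * exp (e(2n) - e(n+k) - e(n-k))]
    exactly ([binomial_stirling]), and [0 <= e(m) <= 1 / (12 m)]
    ([stirling_ge0], [stirling_le]). The upper and lower bounds in terms of
    [bstar] follow at once; for [k = n] the approximation is itself exact.

    The bounds on [e] come from [0 <= e(m) - e(m+1) <= 1/12 (1/m - 1/(m+1))],
    which is an estimate of [artanh] at [1 / (2m + 1)], together with [e(m) -> 0].
    For the limit, Wallis's product gives [0 <= 2 e(m) - e(2m) <= 1 / (4m)],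
    while telescoping gives [e(m) - e(2m) <= 1 / (24m)]. Wallis's product is
    obtained from explicit primitives of the powers of the sine.

    For the Gaussian approximation put [x = k / n] and [t = n^(-1/3)], so that
    [|x| <= t] and [n t^3 = 1]. Then [bstar = n * entropy x - artanh x], and
    [entropy x] differs from [x^2] by O(x^4), so the logarithm of the quotient is
    O(t). Explicit constants ([local_exponent_le], [local_exponent_ge]) place it
    between [- 2 t] (for [t < 1/3]) and [1.24 t], and the elementary inequalities
    [1 + y <= exp y <= 1 / (1 - y)] conclude. *)

Set Implicit Arguments.
Unset Strict Implicit.
Unset Printing Implicit Defensive.

Local Open Scope ring_scope.

Section Analysis.
Context {R : realType}.
Implicit Types (x y t : R) (m n : nat) (k : int).

(** * Bounds for the logarithm and the entropy function *)

Lemma ge0_is_derive_le (f f' : R -> R) (a b : R) : a <= b ->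
  (forall x, a <= x <= b -> is_derive x 1 f (f' x)) ->
  (forall x, a <= x <= b -> 0 <= f' x) -> f a <= f b.
Proof.
move=> ab df f'0.
have [x|z|c /f'0 f'c /eqP] := @MVT_segment R f f' a b ab.
- by rewrite in_itv/= => /andP[ax xb]; apply: df; rewrite !ltW.
- move: z; apply: derivable_within_continuous => x.
  by rewrite in_itv/= => xab; have [] := df _ xab.
- by rewrite subr_eq => /eqP ->; rewrite lerDr mulr_ge0// subr_ge0.
Qed.

Lemma is_derive_1D x : is_derive x 1 (fun y : R => 1 + y) 1.
Proof.
have d := is_deriveD (is_derive_cst (1 : R) x 1) (is_derive_id x 1).
exact: (is_derive_eq d (add0r _)).
Qed.

Lemma is_derive_1B x : is_derive x 1 (fun y : R => 1 - y) (-1).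
Proof.
have d := is_deriveB (is_derive_cst (1 : R) x 1) (is_derive_id x 1).
exact: (is_derive_eq d (add0r _)).
Qed.

Lemma is_derive_ln1D x :
  -1 < x -> is_derive x 1 (fun y => ln (1 + y)) (1 + x)^-1.
Proof.
move=> x1; have l : is_derive (1 + x) 1 (@ln R) (1 + x)^-1.
  by apply: is_derive1_ln; lra.
have d := @is_derive1_comp R (@ln R) _ x _ _ l (is_derive_1D x).
by refine (is_derive_eq d _); rewrite mulr1.
Qed.

Lemma is_derive_ln1B x :
  x < 1 -> is_derive x 1 (fun y => ln (1 - y)) (- (1 - x)^-1).
Proof.
move=> x1; have l : is_derive (1 - x) 1 (@ln R) (1 - x)^-1.
  by apply: is_derive1_ln; lra.
have d := @is_derive1_comp R (@ln R) _ x _ _ l (is_derive_1B x).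
by refine (is_derive_eq d _); rewrite mulrN1.
Qed.

(** This is [2 artanh y]; the odd power series of [artanh] is what makes the
    two bounds below sharp to third order. *)
Definition lnratio y : R := ln (1 + y) - ln (1 - y).

Lemma is_derive_lnratio x :
  -1 < x < 1 -> is_derive x 1 lnratio (2 / (1 - x ^+ 2)).
Proof.
move=> /andP[x1 x2].
have d := is_deriveB (@is_derive_ln1D x x1) (@is_derive_ln1B x x2).
refine (is_derive_eq d _).
by field; apply/and3P; split; nra.
Qed.

(** The difference vanishes at 0 and has derivative
    [2 y^2 / (1 - y^2) >= 0]. *)
Lemma lnratio_ge y : 0 <= y < 1 -> 2 * y <= lnratio y.
Proof.
move=> /andP[y0 y1].
suff : lnratio 0 - 2 * 0 <= lnratio y - 2 * y.
  by rewrite /lnratio subr0 addr0 subrr mulr0 subr0 subr_ge0.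
apply: (@ge0_is_derive_le (fun y => lnratio y - 2 * y)
  (fun x => 2 / (1 - x ^+ 2) - 2)) => //x /andP[x0 xy].
- have xI : -1 < x < 1 by apply/andP; split; lra.
  apply: is_deriveB (@is_derive_lnratio x xI) _.
  have d := is_deriveZ (2 : R) (is_derive_id x 1).
  by refine (is_derive_eq d _); rewrite scaler1.
- have x2 : 0 < 1 - x ^+ 2 by nra.
  by rewrite subr_ge0 ler_pdivlMr//; nra.
Qed.

(** The correction term is the geometric majorant of the tail
    [2 y^3/3 + 2 y^5/5 + ...]; the difference vanishes at 0 and its derivative
    collapses to [(4/3) y^4 / (1 - y^2)^2]. *)
Lemma lnratio_le y : 0 <= y < 1 ->
  lnratio y <= 2 * y + 2 * y ^+ 3 / (3 * (1 - y ^+ 2)).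
Proof.
move=> /andP[y0 y1].
pose f y : R := 2 * y + 2 / 3 * (y ^+ 3 * (1 - y ^+ 2)^-1).
have fE : f y = 2 * y + 2 * y ^+ 3 / (3 * (1 - y ^+ 2)).
  by rewrite /f; field; nra.
suff : f 0 - lnratio 0 <= f y - lnratio y.
  rewrite -fE /lnratio /f subr0 addr0 subrr expr0n/= mul0r !mulr0.
  by rewrite subr0 addr0 subr_ge0.
have D x : 0 <= x <= y -> is_derive x 1 (fun y => f y - lnratio y)
    (4 / 3 * x ^+ 4 / (1 - x ^+ 2) ^+ 2).
  move=> /andP[x0 xy].
  have xI : -1 < x < 1 by apply/andP; split; lra.
  have x2 : 1 - x ^+ 2 != 0 by rewrite gt_eqF//; nra.
  have dX := is_derive_id x 1.
  have d2 := is_deriveB (is_derive_cst (1 : R) x 1) (is_deriveX 2 dX).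
  have d3 := is_deriveM (is_deriveX 3 dX)
               (@is_deriveV R (cst 1 - id ^+ 2) x _ _ x2 d2).
  have d4 := is_deriveD (is_deriveZ (2 : R) dX) (is_deriveZ (2 / 3) d3).
  have d5 := is_deriveB d4 (@is_derive_lnratio x xI).
  refine (is_derive_eq d5 _).
  rewrite /GRing.scale/= !fctE/=.
  by field.
apply: (@ge0_is_derive_le _ _ _ _ y0 D) => x /andP[x0 xy].
by apply: divr_ge0; rewrite ?sqr_ge0//; apply: mulr_ge0; [lra|exact: exprn_ge0].
Qed.


Lemma ln1Dx_le x : -1 < x -> ln (1 + x) <= x.
Proof.
by move=> x1; rewrite -ler_expR lnK ?posrE ?expR_ge1Dx//; lra.
Qed.

(** Up to an affine change this is the binary entropy at [(1 + x) / 2]; [bstar]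
    is [n * entropy (k / n)] plus a lower-order term. *)
Definition entropy x : R := (1 + x) * ln (1 + x) + (1 - x) * ln (1 - x).

Lemma entropyN x : entropy (- x) = entropy x.
Proof. by rewrite /entropy opprK addrC. Qed.

Lemma is_derive_entropy x : -1 < x < 1 -> is_derive x 1 entropy (lnratio x).
Proof.
move=> /andP[x1 x2].
have dD := is_deriveM (is_derive_1D x) (@is_derive_ln1D x x1).
have dB := is_deriveM (is_derive_1B x) (@is_derive_ln1B x x2).
refine (is_derive_eq (is_deriveD dD dB) _).
rewrite /GRing.scale/= /lnratio.
by field; apply/andP; split; nra.
Qed.

(** The derivative of the difference is [lnratio x - 2 x], nonnegative on
    [0, 1[; the other half follows by parity. *)
Lemma entropy_ge x : `|x| < 1 -> x ^+ 2 <= entropy x.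
Proof.
wlog x0 : x / 0 <= x => [H|].
  move=> x1; have [/H|/ltW x0] := leP 0 x; first exact.
  by rewrite -entropyN -sqrrN H ?normrN// oppr_ge0.
rewrite ger0_norm// => x1.
suff : entropy 0 - 0 ^+ 2 <= entropy x - x ^+ 2.
  by rewrite {1}/entropy addr0 subr0 ln1 mulr0 addr0 expr0n/= subrr subr_ge0.
have D z : 0 <= z <= x ->
    is_derive z 1 (fun y => entropy y - y ^+ 2) (lnratio z - 2 * z).
  move=> /andP[z0 zx].
  have zI : -1 < z < 1 by apply/andP; split; lra.
  have dX := is_deriveX 2 (is_derive_id z 1).
  have c := is_deriveB (@is_derive_entropy z zI) dX.
  by refine (is_derive_eq c _); rewrite /GRing.scale/= expr1 mulr1.
apply: (@ge0_is_derive_le _ _ _ _ x0 D) => z /andP[z0 zx].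
by rewrite subr_ge0; apply: lnratio_ge; apply/andP; split; lra.
Qed.

(** Writing [entropy x = log (1 - x^2) + x * lnratio x], the bounds
    [log (1 - x^2) <= - x^2] and [lnratio_le] give the claim. *)
Lemma entropy_le x : `|x| < 1 ->
  entropy x <= x ^+ 2 + 2 * x ^+ 4 / (3 * (1 - x ^+ 2)).
Proof.
wlog x0 : x / 0 <= x => [H|].
  move=> x1; have [/H|/ltW x0] := leP 0 x; first exact.
  have := H (- x); rewrite oppr_ge0 normrN entropyN => /(_ x0 x1).
  by rewrite sqrrN (_ : (- x) ^+ 4 = x ^+ 4)//; ring.
rewrite ger0_norm// => x1.
have x2 : 0 < 1 - x ^+ 2 by nra.
have l1 : ln (1 + x) + ln (1 - x) <= - x ^+ 2.
  rewrite -lnM ?posrE; [|lra|lra].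
  rewrite (_ : (1 + x) * (1 - x) = 1 + - x ^+ 2); last by ring.
  by apply: ln1Dx_le; lra.
have l2 : lnratio x <= 2 * x + 2 * x ^+ 3 / (3 * (1 - x ^+ 2)).
  by apply: lnratio_le; rewrite x0.
rewrite (_ : entropy x = (ln (1 + x) + ln (1 - x)) + x * lnratio x); last first.
  by rewrite /entropy /lnratio; ring.
apply: (le_trans (lerD l1 (ler_wpM2l x0 l2))).
by rewrite le_eqVlt; apply/orP; left; apply/eqP; field; lra.
Qed.

(** * Wallis's product *)

(** The primitive of [sin ^+ n] vanishing at 0, by the reduction formula. With
    explicit primitives, Wallis's argument needs monotonicity of differentiable
    functions only and no integral. *)
Fixpoint sin_pow_primitive n : R -> R :=
  match n with
  | 0 => id
  | 1 => fun x => 1 - cos x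
  | (n'.+1 as n1).+1 => fun x =>
      (n1%:R * sin_pow_primitive n' x - sin x ^+ n1 * cos x) / n1.+1%:R
  end.

Lemma is_derive_sin_pow_primitive n x :
  is_derive x 1 (sin_pow_primitive n) (sin x ^+ n).
Proof.
have [m] := ubnP n; elim: m n => // m IH [|[|n]] nm.
- exact: is_derive_id.
- rewrite expr1.
  have c := is_deriveB (is_derive_cst (1:R) x 1) (is_derive_cos x).
  by refine (is_derive_eq c _); rewrite opprK add0r.
have c1 := is_deriveZ (n.+1%:R : R) (IH n (ltnW nm)).
have c2 := is_deriveM (is_deriveX n.+1 (is_derive_sin x)) (is_derive_cos x).
have c3 := is_deriveM (is_deriveB c1 c2) (is_derive_cst (n.+2%:R^-1 : R) x 1).
have -> : sin_pow_primitive n.+2 =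
    ((n.+1%:R : R) \*: sin_pow_primitive n - sin ^+ n.+1 * cos)
    * cst n.+2%:R^-1.
  by apply/funext => z; rewrite [LHS]/= !fctE.
refine (is_derive_eq c3 _).
rewrite /GRing.scale/= !fctE /cst/= mulr0 add0r.
have n2 : n.+2%:R != 0 :> R by rewrite pnatr_eq0.
apply: (mulfI n2); rewrite mulVKf//.
have sc := cos2Dsin2 x.
rewrite !exprS (_ : n.+2%:R = n.+1%:R + 1); last by rewrite -natr1.
set s := sin x ^+ n.
have -> : n.+1%:R * s - (sin x * s * - sin x + cos x * (n.+1%:R * s * cos x))
  = n.+1%:R * s * (1 - cos x ^+ 2) + sin x ^+ 2 * s by ring.
have -> : cos x ^+ 2 = 1 - sin x ^+ 2 by lra.
by ring.
Qed.

Lemma sin_pow_primitive0 n : sin_pow_primitive n 0 = 0.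
Proof.
have [m] := ubnP n; elim: m n => // m IH [|[|n]] nm //=.
  by rewrite cos0 subrr.
by rewrite (IH n (ltnW nm)) sin0 expr0n/= mulr0 mul0r subrr mul0r.
Qed.

(** The integral of [sin ^+ n] over [0, pi / 2]. *)
Definition wallis n : R := sin_pow_primitive n (pi / 2).

Lemma wallisSS n : wallis n.+2 = n.+1%:R / n.+2%:R * wallis n.
Proof. by rewrite /wallis/= cos_pihalf mulr0 subr0 mulrAC. Qed.

Lemma wallis_gt0 n : 0 < wallis n.
Proof.
have [m] := ubnP n; elim: m n => // m IH [|[|n]] nm.
- by rewrite /wallis/= divr_gt0// pi_gt0.
- by rewrite /wallis/= cos_pihalf subr0.
- by rewrite wallisSS mulr_gt0 ?divr_gt0 ?ltr0n// IH// ltnW.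
Qed.

(** Since [0 <= sin x <= 1] on [0, pi / 2], the integrand decreases with
    [n]. *)
Lemma wallis_decr n : wallis n.+1 <= wallis n.
Proof.
suff : sin_pow_primitive n 0 - sin_pow_primitive n.+1 0
       <= wallis n - wallis n.+1.
  by rewrite !sin_pow_primitive0 subrr subr_ge0.
have p0 : 0 <= pi / 2 :> R by rewrite divr_ge0// pi_ge0.
have D x : 0 <= x <= pi / 2 -> is_derive x 1
    (fun x => sin_pow_primitive n x - sin_pow_primitive n.+1 x)
    (sin x ^+ n - sin x ^+ n.+1).
  have d m := is_derive_sin_pow_primitive m x.
  by move=> _; exact: (is_deriveB (d n) (d n.+1)).
apply: (@ge0_is_derive_le _ _ _ _ p0 D) => x /andP[x0 xp].
have s0 : 0 <= sin x.
  apply: sin_ge0_pi; rewrite x0/= (le_trans xp)// ler_pdivrMr//.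
  by have := pi_ge0 R; lra.
by rewrite subr_ge0 exprS ler_piMl ?exprn_ge0// sin_le1.
Qed.

(** The recurrence makes this product independent of [n]. *)
Lemma wallis_mul n : n.+1%:R * (wallis n * wallis n.+1) = pi / 2.
Proof.
elim: n => [|n IH]; first by rewrite mul1r /wallis/= cos_pihalf subr0 mulr1.
rewrite wallisSS -IH; have : n.+2%:R != 0 :> R by rewrite pnatr_eq0.
by move: (n.+2%:R) (n.+1%:R) => a b a0; field.
Qed.

Lemma wallis_even n :
  wallis n.*2 = pi / 2 * (n.*2)`!%:R / (n`!%:R ^+ 2 * 2 ^+ n.*2).
Proof.
elim: n => [|n IH]; first by rewrite /wallis/= fact0 expr0 expr1n !mulr1 divr1.
rewrite doubleS wallisSS IH !factS !natrM !exprS.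
rewrite (_ : n.*2.+2%:R = 2 * n.+1%:R); last by rewrite -natrM mul2n doubleS.
have a0 : n.+1%:R != 0 :> R by rewrite pnatr_eq0.
have b0 : n`!%:R != 0 :> R by rewrite pnatr_eq0 -lt0n fact_gt0.
have c0 : 2 ^+ n.*2 != 0 :> R by rewrite expf_neq0.
move: n.+1%:R n`!%:R (2 ^+ n.*2) n.*2.+1%:R a0 b0 c0 => a b c e a0 b0 c0.
by field; rewrite a0 b0 c0.
Qed.

(** * Stirling's formula with error bounds *)

(** The logarithm of [n!] divided by [sqrt (2 pi n) (n / e)^n]. *)
Definition stirling_error n : R :=
  ln n`!%:R - (n%:R + 1 / 2) * ln n%:R + n%:R - ln (2 * pi) / 2.

(** The increment is [artanh y / y - 1] with [y = 1 / (2 n + 1)], which lies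
    between 0 and [y^2 / (3 (1 - y^2)) = 1 / (12 n (n + 1))]; the latter
    telescopes. *)
Lemma stirlingB n : (0 < n)%N ->
  0 <= stirling_error n - stirling_error n.+1 <= 12^-1 * (n%:R^-1 - n.+1%:R^-1).
Proof.
move=> n0; have n0' : 0 < n%:R :> R by rewrite ltr0n.
set y : R := (2 * n%:R + 1)^-1.
have yn : n%:R = (y^-1 - 1) / 2 by rewrite /y invrK; field.
have y0 : 0 < y by rewrite /y invr_gt0; lra.
have y1 : y < 1 by rewrite /y invf_lt1; lra.
have L : lnratio y = ln n.+1%:R - ln n%:R.
  rewrite /lnratio -!ln_div ?posrE ?ltr0n//; [|lra|lra].
  congr ln; rewrite -natr1 /y; field.
  by apply/and3P; split; lra.
have -> : stirling_error n - stirling_error n.+1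
          = (n%:R + 1 / 2) * lnratio y - 1.
  rewrite L /stirling_error factS natrM.
  rewrite [ln (_ * _`!%:R)]lnM ?posrE ?ltr0n ?fact_gt0//.
  by rewrite -[n.+1%:R]natr1; field.
have y01 : 0 <= y < 1 by rewrite ltW.
have l1 := lnratio_ge y01.
have l2 := lnratio_le y01.
have -> : n%:R + 1/2 = (2 * y)^-1 by rewrite yn; field; lra.
rewrite subr_ge0 ler_pdivlMl ?mulr_gt0// mulr1 l1/=.
rewrite lerBlDr ler_pdivrMl ?mulr_gt0//.
apply: (le_trans l2); rewrite le_eqVlt; apply/orP; left; apply/eqP.
rewrite -[n.+1%:R]natr1 yn; field.
by apply/and4P; split; nra.
Qed.

Lemma stirling_nincr m n :
  (0 < m <= n)%N -> stirling_error n <= stirling_error m.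
Proof.
move=> /andP[m0]; elim: n => [|n IH]; first by rewrite leqn0 => /eqP ->.
rewrite leq_eqVlt => /predU1P[->//|]; rewrite ltnS => mn.
apply: le_trans (IH mn); rewrite -subr_ge0.
by have /andP[] := stirlingB (leq_trans m0 mn).
Qed.

Lemma stirling_ndecr m n : (0 < m <= n)%N ->
  stirling_error m - 12^-1 * m%:R^-1 <= stirling_error n - 12^-1 * n%:R^-1.
Proof.
move=> /andP[m0]; elim: n => [|n IH]; first by rewrite leqn0 => /eqP ->.
rewrite leq_eqVlt => /predU1P[->//|]; rewrite ltnS => mn.
apply: (le_trans (IH mn)).
have /andP[_] := stirlingB (leq_trans m0 mn).
by move: (n.+1%:R^-1) (n%:R^-1) => a b; lra.
Qed.

(** Wallis's product enters here: the middle term is half the logarithm of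
    [pi / (4 n)] divided by [wallis (2 n) ^ 2], and the latter is squeezed
    between [wallis (2 n) * wallis (2 n + 1)] and
    [wallis (2 n) * wallis (2 n - 1)]. This is what identifies the constant
    [sqrt (2 pi)]. *)
Lemma stirling_double n : (0 < n)%N ->
  0 <= 2 * stirling_error n - stirling_error n.*2 <= 4^-1 * n%:R^-1.
Proof.
move=> n0; have n0' : 0 < n%:R :> R by rewrite ltr0n.
have f0 m : 0 < m`!%:R :> R by rewrite ltr0n fact_gt0.
have pi0 := pi_gt0 R.
have e : 2 * (2 * stirling_error n - stirling_error n.*2)
       = ln (pi / (4 * n%:R)) - ln (wallis n.*2 ^+ 2).
  have nn : n.*2%:R = 2 * n%:R :> R by rewrite -mul2n natrM.
  have two0 : 0 < 2 :> R by [].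
  have l4 : ln (4 * n%:R) = 2 * ln 2 + ln n%:R :> R.
    rewrite (_ : 4 * n%:R = 2 ^+ 2 * n%:R); last by ring.
    by rewrite lnM ?posrE ?exprn_gt0// lnXn// mulr_natl.
  have w1 : ln (wallis n.*2) = ln pi - ln 2 + ln n.*2`!%:R - 2 * ln n`!%:R
                              - 2 * n%:R * ln 2.
    rewrite wallis_even; move: (f0 n) (f0 n.*2).
    move: n`!%:R n.*2`!%:R => a b a0 b0.
    rewrite ln_div ?posrE ?mulr_gt0 ?divr_gt0 ?exprn_gt0//.
    rewrite [ln (_ ^+ 2 * _)]lnM ?posrE ?exprn_gt0// !lnXn//.
    rewrite lnM ?posrE ?divr_gt0// ln_div ?posrE// -[ln 2 *+ _]mulr_natl nn.
    by ring.
  rewrite lnXn ?wallis_gt0// -[_ *+ 2]mulr_natl w1 ln_div ?posrE ?mulr_gt0// l4.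
  rewrite /stirling_error [ln (2 * pi)]lnM ?posrE// nn.
  rewrite [ln (2 * n%:R)]lnM ?posrE//.
  by field.
have w0 := wallis_gt0 n.*2.
have n1 : (n.*2 = n.*2.-1.+1)%N by rewrite prednK// double_gt0.
have up : wallis n.*2 ^+ 2 <= pi / (4 * n%:R).
  have := wallis_mul n.*2.-1; rewrite -n1 => h.
  have -> : pi / (4 * n%:R) = wallis n.*2.-1 * wallis n.*2.
    move/eqP: h; rewrite -mul2n natrM eq_sym => /eqP h.
    have -> : pi = 2 * (pi / 2) :> R by field.
    by rewrite h; field; lra.
  rewrite expr2; apply: ler_wpM2r; first exact: ltW.
  by rewrite [in leLHS]n1 wallis_decr.
have lo : pi / (4 * n%:R) <= (1 + (2 * n%:R)^-1) * wallis n.*2 ^+ 2.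
  have h := wallis_mul n.*2.
  have -> : pi / (4 * n%:R)
            = (1 + (2 * n%:R)^-1) * (wallis n.*2 * wallis n.*2.+1).
    have -> : pi = 2 * (pi / 2) :> R by field.
    have nn : n.*2%:R = 2 * n%:R :> R by rewrite -mul2n natrM.
    by rewrite -h -[n.*2.+1%:R]natr1 nn; field; lra.
  rewrite ler_pM2l; last by rewrite addr_gt0// invr_gt0 mulr_gt0.
  by rewrite expr2; apply: ler_wpM2l (wallis_decr _); exact: ltW.
have l1 : ln (wallis n.*2 ^+ 2) <= ln (pi / (4 * n%:R)).
  by rewrite ler_ln ?posrE ?exprn_gt0// divr_gt0// mulr_gt0.
have v0 : 0 < (2 * n%:R)^-1 :> R by rewrite invr_gt0 mulr_gt0.
have l2 : ln (pi / (4 * n%:R)) <= (2 * n%:R)^-1 + ln (wallis n.*2 ^+ 2).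
  apply: (@le_trans _ _ (ln ((1 + (2 * n%:R)^-1) * wallis n.*2 ^+ 2))).
    by rewrite ler_ln ?posrE ?mulr_gt0 ?exprn_gt0 ?divr_gt0 ?mulr_gt0//; lra.
  rewrite lnM ?posrE ?exprn_gt0//.
  by rewrite lerD2r ln1Dx_le// (lt_trans _ v0)// oppr_lt0.
move: l1 l2 e; rewrite [(2 * _)^-1]invfM.
move: (ln (pi / _)) (ln (wallis _ ^+ 2)) (n%:R^-1) => a b u l1 l2 e.
by apply/andP; split; lra.
Qed.

(** Subtract from [2 e(n) - e(2 n)], which is O(1/n), the difference
    [e(n) - e(2 n)], which telescoping also shows to be O(1/n). *)
Lemma stirling_small n : (0 < n)%N ->
  - n%:R^-1 <= stirling_error n <= n%:R^-1.
Proof.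
move=> n0; have /andP[d1 d2] := stirling_double n0.
have n0' : 0 < n%:R^-1 :> R by rewrite invr_gt0 ltr0n.
have nd : (0 < n <= n.*2)%N by rewrite n0 -addnn leq_addr.
have := stirling_nincr nd; have := stirling_ndecr nd.
have -> : n.*2%:R^-1 = 2^-1 * n%:R^-1 :> R by rewrite -mul2n natrM invfM.
move: (n%:R^-1) d2 n0' => u d2 u0 h1 h2.
by apply/andP; split; lra.
Qed.

Lemma le_of_invn (a b c : R) (N : nat) :
  (forall n, (N < n)%N -> a <= b + c * n%:R^-1) -> a <= b.
Proof.
move=> h; rewrite leNgt; apply/negP => ba.
have ba0 : 0 < a - b by rewrite subr_gt0.
pose n := (N + Num.bound (c / (a - b)))%N.+1.
have n0 : 0 < n%:R :> R by rewrite ltr0n.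
have /h : (N < n)%N by rewrite ltnS leq_addr.
rewrite -lerBlDl ler_pdivlMr// mulrC -ler_pdivlMr// leNgt => /negP; apply.
apply: (le_lt_trans (ler_norm _)).
apply: (lt_le_trans (archi_boundP (normr_ge0 _))).
by rewrite /Num.bound normr_id ler_nat leqW// leq_addl.
Qed.

(** The error decreases, and tends to 0 by [stirling_small]. *)
Lemma stirling_ge0 n : (0 < n)%N -> 0 <= stirling_error n.
Proof.
move=> n0; apply: (@le_of_invn _ _ 1 n) => m nm.
have m0 : (0 < m)%N by exact: leq_ltn_trans nm.
have /andP[s1 _] := stirling_small m0.
have := @stirling_nincr n m; rewrite n0 (ltnW nm) => /(_ isT).
by move: (m%:R^-1) s1 => u; lra.
Qed.

(** The error minus [1 / (12 n)] increases, and tends to 0. *)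
Lemma stirling_le n : (0 < n)%N -> stirling_error n <= 12^-1 * n%:R^-1.
Proof.
move=> n0; apply: (@le_of_invn _ _ 1 n) => m nm.
have m0 : (0 < m)%N by exact: leq_ltn_trans nm.
have /andP[_ s1] := stirling_small m0.
have u0 : 0 < m%:R^-1 :> R by rewrite invr_gt0 ltr0n.
have := @stirling_ndecr n m; rewrite n0 (ltnW nm) => /(_ isT).
by move: (m%:R^-1) (n%:R^-1) u0 s1 => u v; lra.
Qed.


(** * The binomial probability and its exponent *)

Lemma invr_sqrtE y : 0 < y -> 1 / Num.sqrt y = expR (- (ln y / 2)).
Proof.
move=> y0; have s0 : 0 < Num.sqrt y by rewrite sqrtr_gt0.
rewrite expRN div1r; congr (_^-1); apply: ln_inj; rewrite ?posrE ?expR_gt0//.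
rewrite expRK -{2}(sqr_sqrtr (ltW y0)) lnXn// -[_ *+ 2]mulr_natl.
by field.
Qed.

Lemma bstarE n k : (0 < n)%N -> k != n%:Z ->
  bstar R n k = n%:R * entropy (k%:~R / n%:R) - lnratio (k%:~R / n%:R : R) / 2.
Proof.
move=> n0 /negbTE kn; have n0' : n%:R != 0 :> R by rewrite pnatr_eq0 -lt0n.
by rewrite /bstar kn /entropy /lnratio; field.
Qed.

(** The logarithm of the exact correction factor to the approximation
    [exp (- bstar) / sqrt (pi n)]. *)
Definition binomial_error n k : R :=
  stirling_error (2 * n) - stirling_error (absz (n%:Z + k)%R)
  - stirling_error (absz (n%:Z - k)%R).

Lemma ln_fact n : ln n`!%:R
  = stirling_error n + (n%:R + 1 / 2) * ln n%:R - n%:R + ln (2 * pi) / 2 :> R.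
Proof. by rewrite /stirling_error; ring. Qed.

Lemma absz_natr (z : int) : 0 <= z -> (absz z)%:R = z%:~R :> R.
Proof. by move=> z0; rewrite -[RHS]/(z%:~R) -[in RHS](gez0_abs z0). Qed.

(** The binomial coefficient is [(2n)! / ((n+k)! (n-k)!)] times
    [(n+k) / (2n)]; [bstar] is what is left of its logarithm once the three
    factorials are replaced by their Stirling approximations. *)
Lemma binomial_stirling n k : - n%:Z < k < n%:Z ->
  'C(2 * n - 1, absz (n%:Z + k - 1)%R)%:R / 2 ^+ (2 * n - 1) =
  1 / Num.sqrt (pi * n%:R) * expR (- bstar R n k) * expR (binomial_error n k).
Proof.
move=> /andP[nk kn].
have n0 : (0 < n)%N by lia.
have n0' : 0 < n%:R :> R by rewrite ltr0n.
have pi0 := pi_gt0 R.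
rewrite /binomial_error.
have aR : (absz (n%:Z + k)%R)%:R = n%:R + k%:~R :> R.
  by rewrite absz_natr ?rmorphD//=; lia.
have bR : (absz (n%:Z - k)%R)%:R = n%:R - k%:~R :> R.
  by rewrite absz_natr ?rmorphB//=; lia.
have -> : absz (n%:Z + k - 1)%R = (absz (n%:Z + k)%R).-1 by lia.
have a0 : (0 < absz (n%:Z + k)%R)%N by lia.
have b0 : (0 < absz (n%:Z - k)%R)%N by lia.
have ab : (absz (n%:Z + k)%R + absz (n%:Z - k)%R = 2 * n)%N by lia.
rewrite (bstarE n0); last by lia.
move: a0 b0 ab aR bR.
move: (absz (n%:Z + k)%R) (absz (n%:Z - k)%R) => a b a0 b0 ab aR bR.
have x1 : 1 + k%:~R / n%:R = a%:R / n%:R :> R.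
  by rewrite aR mulrDl divff// gt_eqF.
have x2 : 1 - k%:~R / n%:R = b%:R / n%:R :> R.
  by rewrite bR mulrBl divff// gt_eqF.
have a0' : 0 < a%:R :> R by rewrite ltr0n.
have b0' : 0 < b%:R :> R by rewrite ltr0n.
have f0 m : 0 < m`!%:R :> R by rewrite ltr0n fact_gt0.
have C : 'C(2 * n - 1, a.-1)%:R * (a`!%:R * b`!%:R * (2 * n)%:R)
       = (2 * n)`!%:R * a%:R :> R.
  rewrite -!natrM; congr (_%:R).
  have := @bin_fact (2 * n - 1) a.-1.
  rewrite (_ : 2 * n - 1 - a.-1 = b)%N; last by lia.
  rewrite -(prednK a0) factS prednK// => h.
  have -> : ((2 * n)`! = 2 * n * (2 * n - 1)`!)%N.
    rewrite -[in LHS](@prednK (2 * n)) ?muln_gt0// factS.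
    by rewrite prednK ?muln_gt0// subn1.
  rewrite -h; last by lia.
  by move: (binomial _ _) (a.-1)`! b`! => u v w; lia.
have nn : (2 * n)%:R = 2 * n%:R :> R by rewrite natrM.
have nn1 : (2 * n - 1)%:R = 2 * n%:R - 1 :> R.
  by rewrite natrB ?muln_gt0// natrM.
have C0 : 0 < 'C(2 * n - 1, a.-1)%:R :> R by rewrite ltr0n bin_gt0; lia.
have lC : ln 'C(2 * n - 1, a.-1)%:R = ln (2 * n)`!%:R + ln a%:R
   - ln a`!%:R - ln b`!%:R - ln 2 - ln n%:R :> R.
  have := congr1 (@ln R) C; rewrite nn.
  move: (f0 a) (f0 b) (f0 (2 * n)%N) C0.
  move: a`!%:R b`!%:R (2 * n)`!%:R ('C(_, _)%:R) => u v w c u0 v0 w0 c0.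
  rewrite ![ln (c * _)]lnM ?posrE ?mulr_gt0//.
  rewrite [ln (u * v * _)]lnM ?posrE ?mulr_gt0// [ln (u * v)]lnM ?posrE//.
  rewrite [ln (2 * _)]lnM ?posrE// [ln (w * _)]lnM ?posrE//.
  by lra.
rewrite invr_sqrtE ?mulr_gt0// -!expRD.
apply: ln_inj; rewrite ?posrE ?expR_gt0 ?divr_gt0 ?exprn_gt0//.
rewrite expRK ln_div ?posrE ?exprn_gt0// lnXn// -[ln 2 *+ _]mulr_natl nn1 lC.
rewrite !ln_fact nn [ln (pi * _)]lnM ?posrE// [ln (2 * pi)]lnM ?posrE//.
rewrite [ln (2 * n%:R)]lnM ?posrE//.
rewrite /entropy /lnratio x1 x2 !ln_div ?posrE// !aR !bR.
move: (stirling_error (2 * n)) (stirling_error a) (stirling_error b) => u v w.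
by field; exact: lt0r_neq0.
Qed.

Lemma binomial_error_le n k :
  - n%:Z < k < n%:Z -> binomial_error n k <= 24^-1 * n%:R^-1.
Proof.
move=> /andP[nk kn]; rewrite /binomial_error.
have s1 : stirling_error (2 * n) <= 12^-1 * (2 * n)%:R^-1 :> R.
  by apply: stirling_le; lia.
have s2 : 0 <= stirling_error (absz (n%:Z + k)%R) :> R.
  by apply: stirling_ge0; lia.
have s3 : 0 <= stirling_error (absz (n%:Z - k)%R) :> R.
  by apply: stirling_ge0; lia.
move: s1; rewrite natrM invfM.
move: (n%:R^-1) (stirling_error _) (stirling_error _) (stirling_error _) s2 s3.
by move=> u a b c *; lra.
Qed.

(** The right-hand side is [- 1/12 (1/(n+k) + 1/(n-k))], put over a common
    denominator. *)
Lemma binomial_error_ge n k : - n%:Z < k < n%:Z ->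
  - (6 * (1 - (k%:~R / n%:R) ^+ 2))^-1 * n%:R^-1 <= binomial_error n k.
Proof.
move=> /andP[nk kn]; rewrite /binomial_error.
have n0' : 0 < n%:R :> R by rewrite ltr0n; lia.
have s1 : 0 <= stirling_error (2 * n) :> R by apply: stirling_ge0; lia.
have s2 : stirling_error (absz (n%:Z + k)%R) <= 12^-1 * (n%:R + k%:~R)^-1 :> R.
  apply: le_trans (stirling_le _) _; first by lia.
  by rewrite absz_natr ?rmorphD//=; lia.
have s3 : stirling_error (absz (n%:Z - k)%R) <= 12^-1 * (n%:R - k%:~R)^-1 :> R.
  apply: le_trans (stirling_le _) _; first by lia.
  by rewrite absz_natr ?rmorphB//=; lia.
have p1 : 0 < n%:R + k%:~R :> R by rewrite -[n%:R]/(n%:Z%:~R) -intrD ltr0z; lia.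
have p2 : 0 < n%:R - k%:~R :> R by rewrite -[n%:R]/(n%:Z%:~R) -intrB ltr0z; lia.
rewrite mulNr; have -> : (6 * (1 - (k%:~R / n%:R) ^+ 2))^-1 * n%:R^-1
    = 12^-1 * (n%:R + k%:~R)^-1 + 12^-1 * (n%:R - k%:~R)^-1 :> R.
  move: (k%:~R : R) (n%:R : R) n0' p1 p2 => u v v0 p1 p2.
  by field; rewrite subr_sqr mulf_eq0 negb_or !lt0r_neq0.
move: (12^-1 * _) (12^-1 * _) => u v in s2 s3 *.
move: (stirling_error _) (stirling_error _) (stirling_error _) s1 s2 s3.
by move=> a b c *; lra.
Qed.

Lemma ratio_lt1 n k : - n%:Z < k < n%:Z -> `|k%:~R / n%:R| < 1 :> R.
Proof.
move=> /andP[nk kn]; have n0 : 0 < n%:R :> R by rewrite ltr0n; lia.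
rewrite normrM normfV (gtr0_norm n0) ltr_pdivrMr// mul1r.
by rewrite -intr_norm -[n%:R]/(n%:Z%:~R) ltr_int; lia.
Qed.

Lemma expRB_le y : y < 1 -> expR y <= (1 - y)^-1.
Proof.
move=> y1; rewrite -[expR y]invrK -expRN lef_pV2 ?posrE ?expR_gt0 ?subr_gt0//.
exact: expR_ge1Dx.
Qed.

Lemma lnratioN x : lnratio (- x) = - lnratio x.
Proof. by rewrite /lnratio opprK opprB. Qed.

Lemma norm_lnratio_le x : `|x| < 1 ->
  `|lnratio x| <= 2 * `|x| + 2 * `|x| ^+ 3 / (3 * (1 - x ^+ 2)).
Proof.
wlog x0 : x / 0 <= x => [H|].
  move=> x1; have [/H|/ltW x0] := leP 0 x; first exact.
  by have := H (- x); rewrite oppr_ge0 lnratioN !normrN sqrrN; apply.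
rewrite (ger0_norm x0) => x1; have x01 : 0 <= x < 1 by rewrite x0.
rewrite ger0_norm; first exact: lnratio_le.
by apply: le_trans (lnratio_ge x01); rewrite mulr_ge0.
Qed.

(** Here [t] stands for [n^(-1/3)], and [x = k / n]. The exponent equals
    [n (x^2 - entropy x) + lnratio x / 2 + binomial_error n k]. The first term is
    nonpositive, the second at most [t + (t^2 / (3 (1 - t^2))) t], the third at
    most [t^3 / 24]; with [t <= 63 / 100] they add up to less than
    [31 / 25 t]. *)
Lemma local_exponent_le n k t : - n%:Z < k < n%:Z -> n%:R * t ^+ 3 = 1 ->
  `|k%:~R / n%:R| <= t -> 0 < t -> t <= 63 / 100 ->
  k%:~R ^+ 2 / n%:R - bstar R n k + binomial_error n k <= 31 / 25 * t.
Proof.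
move=> nkn nt xt t0 t1.
have n0 : (0 < n)%N by move: nkn; lia.
have n0' : 0 < n%:R :> R by rewrite ltr0n.
have nV : n%:R^-1 = t ^+ 3.
  by apply: (mulfI (lt0r_neq0 n0')); rewrite nt divff ?lt0r_neq0.
have := binomial_error_le nkn; rewrite [X in _ <= _ * X -> _]nV.
rewrite (bstarE n0); last by move: nkn; lia.
set s := binomial_error n k; move: (ratio_lt1 nkn).
have -> : k%:~R ^+ 2 / n%:R = n%:R * (k%:~R / n%:R) ^+ 2 :> R.
  by field; exact: lt0r_neq0.
move: (k%:~R / n%:R) xt => x xt x1 s1.
have e1 : n%:R * x ^+ 2 <= n%:R * entropy x by rewrite ler_pM2l// entropy_ge.
have := le_trans (ler_norm _) (norm_lnratio_le x1).
move: e1; rewrite -[x ^+ 2]real_normK ?num_real//.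
move: (normr_ge0 x) xt; move: `|x| => u u0 ut.
have u3 : u ^+ 3 / (3 * (1 - u ^+ 2)) <= 2223 / 10000 * t.
  by rewrite ler_pdivrMr; nra.
have t3 : t ^+ 3 <= 4 / 10 * t by nra.
rewrite -mulrA.
move: (n%:R * _) (n%:R * _) (u ^+ 3 / _) (lnratio x) u3 => a b c l *.
move: (t ^+ 3) s1 t3 => T *.
lra.
Qed.

(** In the same decomposition the three terms are at least [- 3/4 t],
    [- (1 + 1/9) t] and [- (3/16) t^3], because [1 - x^2 >= 8/9] and
    [n x^4 <= n t^4 = t]. *)
Lemma local_exponent_ge n k t : - n%:Z < k < n%:Z -> n%:R * t ^+ 3 = 1 ->
  `|k%:~R / n%:R| <= t -> 0 < t -> t < 1 / 3 ->
  - (2 * t) <= k%:~R ^+ 2 / n%:R - bstar R n k + binomial_error n k.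
Proof.
move=> nkn nt xt t0 t1.
have n0 : (0 < n)%N by move: nkn; lia.
have n0' : 0 < n%:R :> R by rewrite ltr0n.
have nV : n%:R^-1 = t ^+ 3.
  by apply: (mulfI (lt0r_neq0 n0')); rewrite nt divff ?lt0r_neq0.
have := binomial_error_ge nkn; rewrite [X in _ * X <= _]nV.
rewrite (bstarE n0); last by move: nkn; lia.
set s := binomial_error n k; move: (ratio_lt1 nkn).
have -> : k%:~R ^+ 2 / n%:R = n%:R * (k%:~R / n%:R) ^+ 2 :> R.
  by field; exact: lt0r_neq0.
move: (k%:~R / n%:R) xt => x xt x1 s1.
have := entropy_le x1; rewrite -(ler_pM2l n0').
have := norm_lnratio_le x1; rewrite ler_norml => /andP[+ _].
move: s1; rewrite (_ : x ^+ 4 = (x ^+ 2) ^+ 2); last by ring.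
rewrite -[x ^+ 2]real_normK ?num_real//.
move: (normr_ge0 x) xt; move: `|x| => u u0 ut.
have u2 : 8 / 9 <= 1 - u ^+ 2 by nra.
have u3 : u ^+ 3 / (3 * (1 - u ^+ 2)) <= 1 / 9 * t.
  by rewrite ler_pdivrMr; nra.
have t3 : t ^+ 3 <= 1 / 9 * t by nra.
have i1 : (6 * (1 - u ^+ 2))^-1 <= 3 / 16.
  by rewrite invf_ple ?posrE; nra.
have u4 : n%:R * (2 * (u ^+ 2) ^+ 2 / (3 * (1 - u ^+ 2))) <= 3 / 4 * t.
  rewrite mulrA ler_pdivrMr; last by nra.
  apply: (@le_trans _ _ (n%:R * (2 * (t ^+ 2) ^+ 2))).
    apply: ler_wpM2l; first exact: ltW.
    apply: ler_wpM2l => //.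
    by rewrite -!exprM lerXn2r ?nnegrE// ltW.
  rewrite (_ : _ * _ = 2 * (n%:R * t ^+ 3) * t); last by ring.
  by rewrite nt; nra.
have T0 : 0 < t ^+ 3 by rewrite exprn_gt0.
rewrite [n%:R * (u ^+ 2 + _)]mulrDr -[2 * u ^+ 3 / _]mulrA => e1 e2 e3.
have := le_trans e3 (lerD (lexx _) u4).
have : (6 * (1 - u ^+ 2))^-1 * t ^+ 3 <= 3 / 16 * t ^+ 3 by rewrite ler_pM2r.
move: e1; rewrite mulNr.
lra.
Qed.

End Analysis.

(** * The law of the simple random walk *)

Section RandomWalk.
Local Open Scope classical_set_scope.
Local Open Scope ring_scope.
Context {R : realType} {d : measure_display} {T : measurableType d}.
Context (P : probability T R) (X : nat -> {RV P >-> R}).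
Hypothesis hX : simple_symmetric_steps X.

(** The steps prescribed by the set [J] of up-steps; [i : 'I_l] stands for the
    step number [i + 1], and the pattern is total on [nat] so that it can index
    the events of [mutually_independent]. *)
Definition sign_pattern l (J : {set 'I_l}) (r : nat) : R :=
  if r \in [seq (val i).+1 | i in J] then 1 else -1.

Lemma sign_patternS l (J : {set 'I_l}) (i : 'I_l) :
  sign_pattern J i.+1 = if i \in J then 1 else -1.
Proof.
rewrite /sign_pattern; congr (if _ then _ else _).
apply/fintype.imageP/idP => [[i' i'J /succn_inj/val_inj ->]//|iJ].
by exists i.
Qed.

Lemma sum_sign_pattern l (J : {set 'I_l}) :
  \sum_(1 <= r < l.+1) sign_pattern J r = 2 * #|J|%:R - l%:R.
Proof.
rewrite big_add1/= big_mkord (eq_bigr _ (fun i _ => sign_patternS J i)).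
rewrite (eq_bigr (fun i => 2 * (i \in J)%:R - 1)); last first.
  by move=> i _; case: ifP => _; rewrite ?mulr1 ?mulr0; ring.
rewrite sumrB sumr_const card_ord -mulr_sumr; congr (2 * _ - _).
rewrite -sum1_card natr_sum [RHS]big_mkcond/=.
by apply: eq_bigr => i _; case: ifP.
Qed.

Definition cylinder l (J : {set 'I_l}) : set T :=
  \bigcap_(r in [set` [fset r in iota 1 l]%fset])
    (X r @^-1` [set sign_pattern J r]).

Lemma cylinderP l (J : {set 'I_l}) w : cylinder J w ->
  forall r, (1 <= r <= l)%N -> X r w = sign_pattern J r.
Proof.
by move=> + r rl => /(_ r); apply; rewrite /= !inE mem_iota add1n ltnS.
Qed.

Lemma measurable_cylinder l (J : {set 'I_l}) : measurable (cylinder J).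
Proof.
apply: fin_bigcap_measurable => // r _.
Qed.

Lemma probability_cylinder l (J : {set 'I_l}) :
  P (cylinder J) = ((2 ^+ l)^-1)%:E.
Proof.
have [indep _ step] := hX.
rewrite /cylinder indep; last 2 first.
- by move=> r /=; rewrite !inE mem_iota => /andP[].
- by move=> r _; exact: measurable_set1.
rewrite big_seq (eq_bigr (fun=> (2^-1 : R)%:E)); last first.
  move=> r; rewrite !inE mem_iota => /andP[r1 _].
  by have [p1 pN1] := step r r1; rewrite /sign_pattern; case: ifP.
rewrite -big_seq prodEFin big_const_seq count_predT iter_mulr_1 exprVn.
by rewrite (_ : size _ = l)// card_fseq undup_id ?iota_uniq// size_iota.
Qed.

Lemma walk_cylinder l (J : {set 'I_l}) w : cylinder J w ->
  walk X l w = 2 * #|J|%:R - l%:R.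
Proof.
move=> /cylinderP h; rewrite -sum_sign_pattern /walk.
by apply: eq_big_nat => r; rewrite ltnS => /h.
Qed.

Lemma trivIset_cylinder l : trivIset setT (@cylinder l).
Proof.
move=> J J' _ _ [w [/cylinderP h /cylinderP h']]; apply/setP => i.
have il : (1 <= i.+1 <= l)%N by rewrite ltn_ord.
have := h _ il; rewrite h'// !sign_patternS.
by case: ifP; case: ifP => // _ _ ?; exfalso; lra.
Qed.

(** The cylinders are disjoint and each has probability [2 ^- l]. They need not
    cover the sample space, as the steps are only almost surely [1] or [-1],
    hence an inequality. *)
Lemma probability_cylinders_le l (Q : {pred {set 'I_l}}) (E : set T) :
  measurable E -> (forall J, J \in Q -> cylinder J `<=` E) ->
  ((#|Q|%:R / 2 ^+ l)%:E <= P E)%E.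
Proof.
move=> mE QE; pose F (i : 'I_#|Q|) := cylinder (enum_val i).
have mF i : measurable (F i) by exact: measurable_cylinder.
have tF : trivIset setT F.
  by move=> i i' _ _ /trivIset_cylinder => /(_ Logic.I Logic.I) /enum_val_inj.
have <- : P (\big[setU/set0]_(i < #|Q|) F i) = (#|Q|%:R / 2 ^+ l)%:E.
  rewrite measure_bigsetU_ord// (eq_bigr (fun=> ((2 ^+ l)^-1 : R)%:E)).
    by rewrite sumEFin sumr_const card_ord mulr_natl.
  by move=> i _; exact: probability_cylinder.
apply: le_measure; rewrite ?inE//; first exact: bigsetU_measurable.
by rewrite -bigcup_seq => w [i _]; apply: QE; exact: enum_valP.
Qed.

Lemma measurable_walk l (x : R) : measurable [set w | walk X l w = x].
Proof.
have m : measurable_fun setT (walk X l) by exact: measurable_sum.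
rewrite -[X in measurable X]setTI.
exact: (m measurableT _ (measurable_set1 x)).
Qed.

(** The cylinders with [j] up-steps bound the probability of the event from
    below, the remaining ones that of its complement; the two bounds add up to 1,
    so both are equalities. *)
Lemma probability_walk l j :
  P [set w | walk X l w = 2 * j%:R - l%:R] = ('C(l, j)%:R / 2 ^+ l)%:E.
Proof.
set E := [set w | _].
have mE : measurable E by exact: measurable_walk.
pose Q := [pred J : {set 'I_l} | #|J| == j].
have le1 := @probability_cylinders_le l Q E mE.
have le2 := @probability_cylinders_le l [predC Q] (~` E) (measurableC mE).
have cQ : #|Q| = 'C(l, j).
  rewrite -[in RHS](card_ord l) -card_draws.
  by apply: eq_card => J; rewrite !inE.
have cQC : #|[predC Q]|%:R = 2 ^+ l - 'C(l, j)%:R :> R.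
  apply/eqP; rewrite eq_sym subr_eq -cQ addrC -natrD cardC.
  by rewrite -cardsT -powersetT card_powerset cardsT card_ord natrX.
move: le2; rewrite probability_setC// cQC; move: le1; rewrite cQ.
have -> : P E = (fine (P E))%:E by rewrite fineK// fin_num_measure.
rewrite -EFinB !lee_fin => le1 le2; congr (_%:E); apply/eqP.
rewrite eq_le le1 ?andbT => [|J /eqP JQ w /walk_cylinder]; last by rewrite JQ.
rewrite -lerN2 -(lerD2l 1) (le_trans _ (le2 _))//.
  by rewrite mulrBl divff// expf_neq0.
move=> J /= JQ w /walk_cylinder wJ; rewrite /E/= wJ => /addIr /mulfI.
by rewrite pnatr_eq0 => /(_ isT) /eqP; rewrite eqr_nat; apply/negP.
Qed.

Lemma astarE n (k : int) : (1 <= n)%N -> - n%:Z + 1 <= k ->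
  astar X n k = 'C(2 * n - 1, absz (n%:Z + k - 1)%R)%:R / 2 ^+ (2 * n - 1).
Proof.
move=> n1 kn; rewrite /astar.
have -> : (2 * k - 1)%:~R
          = 2 * (absz (n%:Z + k - 1)%R)%:R - (2 * n - 1)%:R :> R.
  rewrite natrB ?muln_gt0// natrM -[(absz _)%:R]/((Posz _)%:~R).
  have -> : Posz (absz (n%:Z + k - 1)%R) = n%:Z + k - 1.
    by rewrite gez0_abs//; lia.
  by rewrite !(rmorphB, rmorphD, rmorphM)/=; ring.
by rewrite probability_walk.
Qed.
End RandomWalk.

(** * The three estimates *)

Lemma astar_stirling (R : realType) (d : measure_display) (T : measurableType d)
    (P : probability T R) (X : nat -> {RV P >-> R})
    (hX : simple_symmetric_steps X) (n : nat) (k : int) : - n%:Z < k < n%:Z ->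
  astar X n k =
  1 / Num.sqrt (pi * n%:R) * expR (- bstar R n k) * expR (binomial_error n k).
Proof.
move=> nkn; rewrite astarE//; first exact: binomial_stirling.
all: by move: nkn; lia.
Qed.

Theorem theorem2 (R : realType) (d : measure_display) (T : measurableType d)
    (P : probability T R) (X : nat -> {RV P >-> R})
    (hX : simple_symmetric_steps X) :
  [/\ forall (n : nat) (k : int), (1 <= n)%N ->
        - n%:Z + 1 <= k -> k <= n%:Z ->
        astar X n k <
          1 / Num.sqrt (pi * n%:R) * expR (- bstar R n k) *
          expR (2 / (3 * n%:R)),
      forall (r : R) (n : nat) (k : int), 0 < r -> r < 1 -> (1 <= n)%N ->
        `|k%:~R| <= r * n%:R ->
        astar X n k >
          1 / Num.sqrt (pi * n%:R) * expR (- bstar R n k) *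
          expR (- (1 / n%:R) - r ^+ 4 / (3 * (1 - r ^+ 2) ^+ 2 * n%:R))
    & forall (n : nat) (k : int), (4 <= n)%N ->
        `|k%:~R| <= n%:R `^ (2 / 3) :> R ->
        1 - 3 * n%:R `^ (- (1 / 3)) <
          astar X n k /
          (1 / Num.sqrt (pi * n%:R) * expR (- (k%:~R ^+ 2 / n%:R))) /\
        astar X n k /
          (1 / Num.sqrt (pi * n%:R) * expR (- (k%:~R ^+ 2 / n%:R))) <
        1 + 6 * n%:R `^ (- (1 / 3))].
Proof.
have pi0 := pi_gt0 R.
have pre_gt0 n (y : R) : (0 < n)%N -> 0 < 1 / Num.sqrt (pi * n%:R) * expR y.
  move=> n0; rewrite mulr_gt0 ?expR_gt0// divr_gt0// sqrtr_gt0.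
  by rewrite mulr_gt0// ltr0n.
have int_bound n k (r : R) : (0 < n)%N -> r < 1 -> `|k%:~R| <= r * n%:R ->
    - n%:Z < k < n%:Z.
  move=> n0 r1 kr; rewrite -ltr_norml -(ltr_int R) intr_norm.
  by apply: le_lt_trans kr _; rewrite gtr_pMl// ltr0n.
split.
- move=> n k n1 nk kn.
  have n0 : 0 < n%:R :> R by rewrite ltr0n.
  have [->|kn'] := eqVneq k n%:Z; last first.
    have nkn : - n%:Z < k < n%:Z by lia.
    rewrite astar_stirling// ltr_pM2l ?pre_gt0// ltr_expR.
    apply: le_lt_trans (binomial_error_le nkn) _.
    by rewrite invfM mulrA ltr_pM2r ?invr_gt0//; lra.
  (* For [k = n] the approximation [exp (- bstar) / sqrt (pi n)] is exactly
     [2 ^- (2 n - 1)]. *)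
  rewrite astarE//; last by lia.
  have -> : absz (n%:Z + n%:Z - 1)%R = (2 * n - 1)%N by lia.
  rewrite binn /bstar eqxx invr_sqrtE ?mulr_gt0// -!expRD.
  have -> : 1 / 2 ^+ (2 * n - 1) = expR (- ((2 * n%:R - 1) * ln 2)) :> R.
    apply: ln_inj; rewrite ?posrE ?expR_gt0 ?divr_gt0 ?exprn_gt0//.
    rewrite expRK div1r lnV ?posrE ?exprn_gt0// lnXn// -[_ *+ _]mulr_natl.
    by rewrite natrB ?muln_gt0// natrM.
  rewrite ltr_expR -[2 * pi * _]mulrA [ln (2 * _)]lnM ?posrE ?mulr_gt0//.
  have : 0 < 2 / (3 * n%:R) :> R by rewrite divr_gt0// mulr_gt0.
  by move: (2 / _) (ln (pi * _)) => u v; lra.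
- move=> r n k r0 r1 n1 kr.
  have n0 : 0 < n%:R :> R by rewrite ltr0n.
  have nkn := int_bound _ _ _ n1 r1 kr.
  rewrite astar_stirling// ltr_pM2l ?pre_gt0// ltr_expR.
  apply: lt_le_trans (binomial_error_ge nkn).
  have : (k%:~R / n%:R) ^+ 2 <= r ^+ 2 :> R.
    rewrite -real_normK ?num_real// ler_pXn2r ?nnegrE ?(ltW r0)//.
    by rewrite normrM normfV (gtr0_norm n0) ler_pdivrMr.
  move: ((_ / _) ^+ 2) => y yr.
  have s0 : 0 < 1 - r ^+ 2 by nra.
  have -> : - (1 / n%:R) - r ^+ 4 / (3 * (1 - r ^+ 2) ^+ 2 * n%:R)
      = - (1 + r ^+ 4 / (3 * (1 - r ^+ 2) ^+ 2)) * n%:R^-1.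
    by field; rewrite !lt0r_neq0.
  rewrite ltr_pM2r ?invr_gt0// ltrN2.
  apply: (@le_lt_trans _ _ (6 * (1 - r ^+ 2))^-1).
    by rewrite lef_pV2 ?posrE; nra.
  rewrite (_ : r ^+ 4 = (r ^+ 2) ^+ 2); last by ring.
  rewrite -subr_gt0; move: (r ^+ 2) s0 => s s0.
  (* With [s = r^2] the numerator is [8 u^2 - 5 u + 2] in [u = 1 - s], whose
     discriminant is negative. *)
  rewrite (_ : _ - _ = (6 * (1 - s) ^+ 2 + 2 * s ^+ 2 - (1 - s))
                       / (6 * (1 - s) ^+ 2)); last first.
    by field; rewrite lt0r_neq0.
  by rewrite divr_gt0//; nra.
- move=> n k n4 kt.
  have n1 : (0 < n)%N by lia.
  have n0 : 0 < n%:R :> R by rewrite ltr0n.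
  set t : R := n%:R `^ (- (1 / 3)).
  have t0 : 0 < t by rewrite powR_gt0.
  have nt : n%:R * t ^+ 3 = 1.
    rewrite -powR_mulrn ?ltW// /t -powRrM.
    rewrite (_ : - (1 / 3) * 3 = -1) ?powR_inv1 ?ltW//; last by field.
    by rewrite divff ?lt0r_neq0.
  have n23 : n%:R `^ (2 / 3) = t * n%:R :> R.
    rewrite (_ : 2 / 3 = - (1 / 3) + 1); last by field.
    by rewrite powRD ?powRr1 ?ltW// lt0r_neq0 ?implybT.
  rewrite n23 in kt.
  have n4' : 4 <= n%:R :> R by rewrite (ler_nat R 4 n).
  (* [n >= 4] means [t^3 <= 1/4], whereas [0.63^3 > 1/4]. *)
  have t1 : t <= 63 / 100.
    rewrite leNgt; apply/negP => t1.
    have : (63 / 100) ^+ 3 < t ^+ 3 by rewrite ltrXn2r// ?nnegrE ?ltW//; lra.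
    by nra.
  have nkn : - n%:Z < k < n%:Z by apply: int_bound kt => //; lra.
  have xt : `|k%:~R / n%:R| <= t :> R.
    by rewrite normrM normfV (gtr0_norm n0) ler_pdivrMr.
  have -> : astar X n k
        / (1 / Num.sqrt (pi * n%:R) * expR (- (k%:~R ^+ 2 / n%:R)))
      = expR (k%:~R ^+ 2 / n%:R - bstar R n k + binomial_error n k).
    rewrite astar_stirling//.
    apply: (canLR (mulfK (lt0r_neq0 (pre_gt0 _ _ n1)))).
    by rewrite [RHS]mulrCA -expRD -mulrA -expRD; congr (_ * expR _); ring.
  split.
    (* For [t >= 1/3] the lower bound is nonpositive. *)
    have [t3|t3] := leP (1 / 3) t.
      by apply: le_lt_trans (expR_gt0 _); lra.
    apply: lt_le_trans (expR_ge1Dx _).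
    by have := local_exponent_ge nkn nt xt t0 t3; lra.
  have E := local_exponent_le nkn nt xt t0 t1.
  apply: (@le_lt_trans _ _ (expR (31 / 25 * t))); first by rewrite ler_expR.
  apply: le_lt_trans (expRB_le _) _; first by lra.
  (* [1 < (1 + 6 t) (1 - 31/25 t)] amounts to [t < 0.6397], which the bound
     [t <= 0.63] just grants. *)
  have d0 : 0 < 1 - 31 / 25 * t by lra.
  by rewrite -[ltLHS]mul1r ltr_pdivrMr//; nra.
Qed.
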